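(* Let $F=G+H$ be as in the context, where each $h_j:\mathbb{R}^n\to\mathbb{R}$ is continuously differentiable, each $g_j:\mathbb{R}^n\to\mathbb{R}\cup\{+\infty\}$ is proper, convex and lower semicontinuous, and $\mathrm{dom}(G)$ is convex and compact. Assume in addition that, for every $j\in\mathcal{J}$, $g_j$ is Lipschitz continuous with constant $L_{g_j}>0$ on $\mathrm{dom}(g_j)$ and $\nabla h_j$ is Lipschitz continuous with constant $L_j>0$. Let $(x^k)_{k\in\mathbb{N}}$ be an infinite sequence generated by the generalized conditional gradient method with Armijo step sizes (so that $\theta(x^k)<0$ for all $k$). Then $\lim_{k\to\infty}F(x^k)=F(x^* )$ for some $x^*\in\mathrm{dom}(G)$. Moreover: (i) $\lim_{k\to\infty}\theta(x^k)=0$; (ii) for every positive integer $N$, $$\min\{|\theta(x^k)|: k=0,1,\dots,N-1\}\le\sqrt{\frac{f_{j^*}(x^0)-f_{j^*}^{\inf}}{\zeta\gamma N}} .$$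
   Context: $\mathcal{J}=\{1,\dots,m\}$, $\mathbb{N}=\{0,1,2,\dots\}$, $e=(1,\dots,1)^T\in\mathbb{R}^m$, $\|\cdot\|$ is the Euclidean norm, and $u\preceq v$ in $\mathbb{R}^m$ means $v-u\in\mathbb{R}^m_+$. $F=(f_1,\dots,f_m)$, $f_j=g_j+h_j$, $G=(g_1,\dots,g_m)$, $H=(h_1,\dots,h_m)$, $\mathrm{dom}(g_j)=\{x\in\mathbb{R}^n:g_j(x)<+\infty\}$, $\mathrm{dom}(G)=\bigcap_{j\in\mathcal{J}}\mathrm{dom}(g_j)$. For $x\in\mathrm{dom}(G)$, $\theta(x):=\min_{u\in\mathbb{R}^n}\max_{j\in\mathcal{J}}\big(g_j(u)-g_j(x)+\langle\nabla h_j(x),u-x\rangle\big)\le 0$, and $p(x)\in\mathrm{dom}(G)$ denotes a point $u$ attaining this minimum. Generalized conditional gradient method: choose $x^0\in\mathrm{dom}(G)$; for $k=0,1,\dots$ compute a minimizer $p(x^k)$ and the value $\theta(x^k)$; stop if $\theta(x^k)=0$; otherwise compute a step size $\lambda_k\in(0,1]$ and set $x^{k+1}:=x^k+\lambda_k(p(x^k)-x^k)$. Armijo step size: fix $\zeta\in(0,1)$ and $0<\omega_1<\omega_2<1$. Set $\lambda_{k_0}=1$, $\ell=0$. If $F(x^k+\lambda_{k_\ell}[p(x^k)-x^k])\preceq F(x^k)-\zeta\lambda_{k_\ell}|\theta(x^k)|e$, then set $\lambda_k:=\lambda_{k_\ell}$ and finish; otherwise choose any $\lambda_{k_{\ell+1}}\in[\omega_1\lambda_{k_\ell},\omega_2\lambda_{k_\ell}]$,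 increase $\ell$ by one and repeat the test. Constants: $\Omega>0$ is a fixed number with $\Omega\ge\mathrm{diam}(\mathrm{dom}(G))$; $L=\max_{j\in\mathcal{J}}L_j$; $L_G=\max_{j\in\mathcal{J}}L_{g_j}$; $\rho=\sup\{\|\nabla h_j(x)\|: x\in\mathrm{dom}(G),\ j\in\mathcal{J}\}$; $$\gamma=\min\Big\{\frac{1}{(\rho+L_G)\Omega},\ \frac{2\omega_1(1-\zeta)}{L\Omega^2}\Big\}.$$ Moreover $f_{j^*}(x^0):=\max\{f_j(x^0): j\in\mathcal{J}\}$ and $f_{j^*}^{\inf}:=\min\{f_j^*: j\in\mathcal{J}\}$, where $f_j^*:=\inf\{f_j(x): x\in\mathrm{dom}(G)\}$. *)

(* Defs.v *)
(* MathComp-Analysis; R^n is 'rV[R]_n, and the index set of the m >= 1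
   objectives is 'I_m.+1, so that the maxima and minima over it are never
   empty. *)
From HB Require Import structures.
From mathcomp Require Import all_boot all_order all_algebra.
From mathcomp Require Import all_classical all_reals all_analysis.
Set Implicit Arguments.
Unset Strict Implicit.
Unset Printing Implicit Defensive.
Import Order.TTheory GRing.Theory Num.Theory.
Import numFieldNormedType.Exports.
Local Open Scope classical_set_scope.
Local Open Scope ring_scope.

Section Euclidean.
Context {R : realType} {n : nat}.
Implicit Types (u v : 'rV[R]_n) (A : set 'rV[R]_n).

Definition dotp u v : R := \sum_i u 0 i * v 0 i.

(* The library norm on 'rV[R]_n is the sup norm: it induces the same topology
   but not the same Lipschitz constants and diameters. *)
Definition enorm u : R := Num.sqrt (dotp u u).

(* Componentwise order; the library puts no order on matrices. *)
Definition prec u v : Prop := forall i, u 0 i <= v 0 i.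

Definition diam A : \bar R :=
  ereal_sup [set (enorm (x - y))%:E | x in A & y in A].

Definition grad (h : 'rV[R]_n -> R) (x : 'rV[R]_n) : 'rV[R]_n :=
  \row_i 'D_(delta_mx 0 i) h x.

Definition continuously_differentiable (h : 'rV[R]_n -> R) : Prop :=
  (forall x, differentiable h x) /\ continuous (grad h).

Definition lipschitz_gradient (L : R) (h : 'rV[R]_n -> R) : Prop :=
  forall x y, enorm (grad h x - grad h y) <= L * enorm (x - y).

End Euclidean.

Section ExtendedValued.
Context {R : realType} {n : nat}.
Implicit Type g : 'rV[R]_n -> \bar R.
Local Open Scope ereal_scope.

Definition edom g : set 'rV[R]_n := [set x | g x < +oo].

Definition eproper g : Prop := (forall x, g x != -oo) /\ edom g !=set0.

(* The library's [convex_function] only covers real-valued functions.  At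
   t = 0 and t = 1 the convention 0 * +oo = 0 makes the inequality trivial. *)
Definition econvex g : Prop :=
  forall (x y : 'rV[R]_n) (t : R), (0 <= t <= 1)%R ->
    g (t *: x + (1 - t) *: y)%R <= t%:E * g x + (1 - t)%:E * g y.

Definition lipschitz_on_dom (L : R) g : Prop :=
  forall x y, edom g x -> edom g y ->
    (`|fine (g x) - fine (g y)| <= L * enorm (x - y))%R.

End ExtendedValued.

Definition maxJ {R : realType} {m : nat} (a : 'I_m.+1 -> R) : R :=
  \big[Num.max/a ord0]_j a j.
Definition minJ {R : realType} {m : nat} (a : 'I_m.+1 -> R) : R :=
  \big[Num.min/a ord0]_j a j.

Section CompositeProblem.
Context {R : realType} {n m : nat}.
Variables (g : 'I_m.+1 -> 'rV[R]_n -> \bar R) (h : 'I_m.+1 -> 'rV[R]_n -> R).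

Definition domG : set 'rV[R]_n := \bigcap_(j in [set: 'I_m.+1]) edom (g j).

Definition fobj (j : 'I_m.+1) (x : 'rV[R]_n) : \bar R := (g j x + (h j x)%:E)%E.

(* [fine] is harmless: Fobj is only evaluated on domG, where fobj j is finite. *)
Definition Fobj (x : 'rV[R]_n) : 'rV[R]_m.+1 := \row_j fine (fobj j x).

(* The value at u of the function minimized in the subproblem at x. *)
Definition subpb (x u : 'rV[R]_n) : \bar R :=
  (\big[maxe/-oo]_j
     (g j u - g j x + (dotp (grad (h j) x) (u - x))%:E))%E.

(* For x in domG the infimum is a real number whenever it is attained. *)
Definition theta (x : 'rV[R]_n) : R := fine (ereal_inf (range (subpb x))).

Definition is_minimizer (x p : 'rV[R]_n) : Prop :=
  domG p /\ forall u, (subpb x p <= subpb x u)%E.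

(* An infinite run: the stopping test theta = 0 never succeeds. *)
Definition gcg_run (x p : nat -> 'rV[R]_n) (lam : nat -> R) : Prop :=
  domG (x 0%N) /\
  forall k, [/\ is_minimizer (x k) (p k), theta (x k) != 0,
    0 < lam k <= 1 & x k.+1 = x k + lam k *: (p k - x k)].

Definition armijo_test (zeta : R) (x p : 'rV[R]_n) (l : R) : Prop :=
  prec (Fobj (x + l *: (p - x)))
       (Fobj x - (zeta * l * `|theta x|) *: const_mx 1).

(* t i, for i <= l, are the successive trial steps; t l is the first accepted. *)
Definition armijo_step (zeta w1 w2 : R) (x p : 'rV[R]_n) (lam : R) : Prop :=
  exists (l : nat) (t : nat -> R),
    [/\ t 0%N = 1,
        forall i, (i < l)%N -> ~ armijo_test zeta x p (t i) /\
                               w1 * t i <= t i.+1 <= w2 * t i,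
        armijo_test zeta x p (t l) & lam = t l].

(* The supremum is finite when domG is compact and the h j are C^1. *)
Definition rho : R :=
  sup [set enorm (grad (h j) x) | x in domG & j in [set: 'I_m.+1]].

Definition fobj_inf (j : 'I_m.+1) : R := inf [set Fobj x 0 j | x in domG].

Definition gcg_gamma (Lg L : 'I_m.+1 -> R) (Omega zeta w1 : R) : R :=
  Num.min (1 / ((rho + maxJ Lg) * Omega))
          (2 * w1 * (1 - zeta) / (maxJ L * Omega ^+ 2)).

End CompositeProblem.

(* Main.v *)
Require Import Defs.
From HB Require Import structures.
From mathcomp Require Import all_boot all_order all_algebra.
From mathcomp Require Import all_classical all_reals all_analysis.
From mathcomp Require Import ring lra.
Set Implicit Arguments.
Unset Strict Implicit.
Unset Printing Implicit Defensive.
Import Order.TTheory GRing.Theory Num.Theory.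
Import numFieldNormedType.Exports.
Local Open Scope classical_set_scope.
Local Open Scope ring_scope.

(** Three estimates carry the proof.

    First, convexity of [g j] and the descent lemma for [h j] bound the objective
    along the segment from [x] to the minimizer [p] ([Fobj_segment_le]):
      [f_j (x + t (p - x)) <= f_j x - t |theta x| + L Omega^2 t^2 / 2].

    Second, the accepted step is proportional to [|theta x|] or longer
    ([armijo_step_ge]): by the first estimate a rejected trial step [t] satisfies
    [t >= 2 (1 - zeta) |theta x| / (L Omega^2)], and the accepted step is at least
    [w1] times the last rejected one; if nothing was rejected the step is [1],
    which suffices because [|theta x| <= (rho + L_G) Omega].  Hence
    [lam >= gamma |theta x|], and the Armijo test gives, for every objective,
      [zeta gamma theta(x_k)^2 <= f_j(x_k) - f_j(x_(k+1))]
    ([armijo_decrease]).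

    Third, each [f_j] is bounded below on [domG] ([Fobj_has_lbound]).  The
    monotone sequences [f_j(x_k)] therefore converge, their decrements tend to
    zero, and so does [theta(x_k)].  A compactness argument identifies the limit
    as [F(xs)] for an accumulation point [xs] of the iterates ([Fobj_cluster]);
    the iterates themselves need not converge.  Summing the decrements of a single
    objective over [N] steps gives the rate. *)

(** * Euclidean geometry and the descent lemma *)

Section EuclideanGeometry.
Context {R : realType} {n : nat}.
Implicit Types u v w x y d : 'rV[R]_n.

Lemma dotpC u v : dotp u v = dotp v u.
Proof. by apply: eq_bigr => i _; rewrite mulrC. Qed.

Lemma dotpDl u v w : dotp (u + v) w = dotp u w + dotp v w.
Proof. by rewrite -big_split; apply: eq_bigr => i _; rewrite mxE mulrDl. Qed.

Lemma dotpZl a u v : dotp (a *: u) v = a * dotp u v.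
Proof. by rewrite mulr_sumr; apply: eq_bigr => i _; rewrite mxE mulrA. Qed.

Lemma dotpBl u v w : dotp (u - v) w = dotp u w - dotp v w.
Proof. by rewrite -scaleN1r dotpDl dotpZl mulN1r. Qed.

Lemma dotpDr u v w : dotp w (u + v) = dotp w u + dotp w v.
Proof. by rewrite dotpC dotpDl !(dotpC w). Qed.

Lemma dotpZr a u v : dotp u (a *: v) = a * dotp u v.
Proof. by rewrite dotpC dotpZl dotpC. Qed.

Lemma dotpBr u v w : dotp w (u - v) = dotp w u - dotp w v.
Proof. by rewrite dotpC dotpBl !(dotpC w). Qed.

Lemma dotp_ge0 u : 0 <= dotp u u.
Proof. by apply: sumr_ge0 => i _; rewrite -expr2 sqr_ge0. Qed.

Lemma dotp_eq0 u : dotp u u = 0 -> u = 0.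
Proof.
move=> /eqP; rewrite psumr_eq0 => [/allP u0|i _]; last by rewrite -expr2 sqr_ge0.
apply/rowP => i; rewrite mxE; apply/eqP.
by have := u0 i (mem_index_enum i); rewrite /= -expr2 sqrf_eq0.
Qed.

Lemma enorm_ge0 u : 0 <= enorm u.
Proof. exact: sqrtr_ge0. Qed.

Lemma sqr_enorm u : enorm u ^+ 2 = dotp u u.
Proof. by rewrite sqr_sqrtr // dotp_ge0. Qed.

Lemma enormZ a u : enorm (a *: u) = `|a| * enorm u.
Proof.
by rewrite /enorm dotpZl dotpZr mulrA -expr2 sqrtrM ?sqr_ge0 // sqrtr_sqr.
Qed.

(** Cauchy-Schwarz, from the nonnegativity of the squared norm of
    [|v|^2 u - <u, v> v]. *)
Lemma dotp_le_enorm u v : `|dotp u v| <= enorm u * enorm v.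
Proof.
have [v0|v_neq0] := eqVneq (dotp v v) 0.
  have -> : dotp u v = 0 by rewrite (dotp_eq0 v0) -(subrr u) dotpBr subrr.
  by rewrite normr0 mulr_ge0 ?enorm_ge0.
have v_gt0 : 0 < dotp v v by rewrite lt_def v_neq0 dotp_ge0.
have := dotp_ge0 (dotp v v *: u - dotp u v *: v).
have -> : dotp (dotp v v *: u - dotp u v *: v) (dotp v v *: u - dotp u v *: v)
    = dotp v v * (dotp u u * dotp v v - dotp u v ^+ 2).
  by rewrite !dotpBl !dotpBr !dotpZl !dotpZr (dotpC v u); ring.
rewrite pmulr_rge0 // subr_ge0 => cs.
by rewrite -sqrtr_sqr -sqrtrM ?dotp_ge0 // ler_sqrt // mulr_ge0 ?dotp_ge0.
Qed.

Lemma enormD u v : enorm (u + v) <= enorm u + enorm v.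
Proof.
rewrite -(@ler_pXn2r _ 2) ?nnegrE ?addr_ge0 ?enorm_ge0 //.
rewrite sqrrD !sqr_enorm dotpDl !dotpDr (dotpC v u).
have := le_trans (ler_norm _) (dotp_le_enorm u v).
lra.
Qed.

(** The Euclidean norm is continuous for the product topology, which is that of
    the sup norm. *)
Lemma enorm_continuous : continuous (@enorm R n).
Proof.
move=> u; apply: (@continuous_comp _ _ _ (fun v => dotp v v) Num.sqrt).
  2: exact: sqrt_continuous.
have : (fun v => dotp v v) v @[v --> u] --> dotp u u.
  refine (@cvg_big _ _ _ _ _ _ _ (nbhs u) _ (fun i v => v 0 i * v 0 i) _ _ _).
    exact: add_continuous.
  move=> i _.
  by apply: cvgM; apply: coord_continuous.
exact.
Qed.

Lemma cvg_enorm_sub x : enorm (y - x) @[y --> x] --> (0 : R).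
Proof.
have <- : enorm (x - x) = 0.
  by rewrite subrr /enorm /dotp big1 ?sqrtr0 // => i _; rewrite mxE mul0r.
have sub_cvg : y - x @[y --> x] --> x - x.
  exact: (cvgB (F := nbhs x) cvg_id (cvg_cst x)).
by apply: (cvg_comp _ _ sub_cvg); exact: enorm_continuous.
Qed.

Lemma derive_grad (h : 'rV[R]_n -> R) x d :
  differentiable h x -> 'D_d h x = dotp (grad h x) d.
Proof.
move=> dh; rewrite deriveE // {1}(row_sum_delta d) linear_sum.
by apply: eq_bigr => i _; rewrite linearZ mxE -deriveE //= mulrC.
Qed.

Lemma is_derive_along_line (h : 'rV[R]_n -> R) x d (t : R) :
  (forall y, differentiable h y) ->
  is_derive t 1 (fun s => h (x + s *: d)) (dotp (grad h (x + t *: d)) d).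
Proof.
move=> dh; have dhd : derivable h (x + t *: d) d by exact: diff_derivable.
have E : (fun s : R => s^-1 *: (((fun s => h (x + s *: d)) \o shift t) (s *: 1)
    - h (x + t *: d))) =
  (fun s : R => s^-1 *: ((h \o shift (x + t *: d)) (s *: d) - h (x + t *: d))).
  apply/funext => s /=; congr (_ *: (h _ - _)).
  by rewrite -[s *: 1]/(s * 1) mulr1 scalerDl addrCA.
split; first by rewrite /derivable E.
by rewrite -(derive_grad _ (dh _)) /derive E.
Qed.

(** The descent lemma.  Along the segment, the gap
    [h (x + t d) - h x - t <grad h x, d> - t^2 L |d|^2 / 2]
    has derivative [<grad h (x + t d) - grad h x, d> - t L |d|^2], which
    is nonpositive by Cauchy-Schwarz and the Lipschitz bound. *)
Lemma descent_lemma (h : 'rV[R]_n -> R) (L : R) x d :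
  (forall y, differentiable h y) -> lipschitz_gradient L h ->
  h (x + d) <= h x + dotp (grad h x) d + L / 2 * enorm d ^+ 2.
Proof.
move=> dh hL.
pose c := dotp (grad h x) d; pose q := L / 2 * enorm d ^+ 2.
pose psi := fun s : R => h (x + s *: d) - (s * c + s ^+ 2 * q).
pose dpsi := fun s : R => dotp (grad h (x + s *: d)) d - (c + s *+ 2 * q).
have dpsiE (t : R) : is_derive t 1 psi (dpsi t).
  apply: is_deriveB; first exact: is_derive_along_line.
  apply: is_derive_eq.
  rewrite /GRing.scale /=; ring.
have dpsi_le0 t : 0 < t -> dpsi t <= 0.
  move=> t0; rewrite /dpsi /c opprD addrA -dotpBl subr_le0.
  apply: (le_trans (le_trans (ler_norm _) (dotp_le_enorm _ _))).
  apply: (le_trans (ler_wpM2r (enorm_ge0 d) (hL _ _))).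
  rewrite addrAC subrr add0r enormZ gtr0_norm // /q; nra.
have psi_cont : {within `[0, 1], continuous psi}.
  apply: continuous_subspaceT => t; apply: differentiable_continuous.
  by apply/derivable1_diffP; have [] := dpsiE t.
have := @ler0_derive1_le_cc _ psi 0 1 _ _ psi_cont 1 0.
have -> : psi 1 = h (x + d) - (c + q) by rewrite /psi scale1r mul1r expr1n mul1r.
have -> : psi 0 = h x by rewrite /psi scale0r addr0 expr0n !mul0r addr0 subr0.
rewrite -addrA lerBlDr; apply; rewrite ?in_itv /= ?lexx ?ler01 //.
move=> t; rewrite in_itv /= => /andP[t0 _].
by rewrite derive1E; have [_ ->] := dpsiE t; exact: dpsi_le0.
Qed.

End EuclideanGeometry.

(** * Maxima and minima over the objectives *)

Section FiniteExtrema.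
Context {R : realType} {m : nat}.
Implicit Types (a : 'I_m.+1 -> R) (c : R).

Lemma maxJ_ge a j : a j <= maxJ a.
Proof. exact: le_bigmax. Qed.

Lemma maxJ_le a c : (forall j, a j <= c) -> maxJ a <= c.
Proof. by move=> ac; apply: bigmax_le. Qed.

Lemma minJ_le a j : minJ a <= a j.
Proof. exact: bigmin_le. Qed.

Lemma maxJ_gt0 a : (forall j, 0 < a j) -> 0 < maxJ a.
Proof. by move=> a0; apply: lt_le_trans (maxJ_ge a ord0). Qed.

(** Although the extended-real maximum starts from [-oo], it is a maximum over a
    nonempty index set and so agrees with the real one. *)
Lemma bigmaxe_maxJ a : (\big[maxe/-oo]_j (a j)%:E = (maxJ a)%:E)%E.
Proof.
rewrite /maxJ -EFin_bigmax; apply/le_anti/andP; split.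
  by apply/bigmax_leP; split=> [|j _]; rewrite ?leNye ?le_bigmax.
by apply/bigmax_leP; split=> [|j _]; rewrite (le_bigmax _ (fun j => (a j)%:E)).
Qed.

End FiniteExtrema.

(** * The objective, the subproblem and the Armijo step *)

Section CompositeObjective.
Context {R : realType} {n m : nat}.
Variables (g : 'I_m.+1 -> 'rV[R]_n -> \bar R) (h : 'I_m.+1 -> 'rV[R]_n -> R).
Variables (Lg L : 'I_m.+1 -> R) (Omega : R).
Hypothesis h_diff : forall j x, differentiable (h j) x.
Hypothesis g_proper : forall j, eproper (g j).
Hypothesis g_convex : forall j, econvex (g j).
Hypothesis domG_compact : compact (domG g).
Hypothesis Lg_gt0 : forall j, 0 < Lg j.
Hypothesis g_lip : forall j, lipschitz_on_dom (Lg j) (g j).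
Hypothesis L_gt0 : forall j, 0 < L j.
Hypothesis h_lip : forall j, lipschitz_gradient (L j) (h j).
Hypothesis Omega_gt0 : 0 < Omega.
Hypothesis Omega_diam : (diam (domG g) <= Omega%:E)%E.
Implicit Types (x y p u : 'rV[R]_n) (j : 'I_m.+1) (t zeta : R).

Local Notation gR j x := (fine (g j x)).

Lemma g_fin_num j x : domG g x -> g j x \is a fin_num.
Proof.
move=> Dx; rewrite fin_numE (g_proper j).1 /=.
by rewrite lt_eqF //; exact: Dx.
Qed.

Lemma FobjE j x : domG g x -> Fobj g h x 0 j = gR j x + h j x.
Proof. by move=> Dx; rewrite mxE fineD // g_fin_num. Qed.

Lemma enorm_domG_le x y : domG g x -> domG g y -> enorm (x - y) <= Omega.
Proof.
move=> Dx Dy; rewrite -lee_fin; apply: le_trans Omega_diam.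
by apply: ereal_sup_ubound; exists x => //; exists y.
Qed.

Lemma g_lip_domG j x y :
  domG g x -> domG g y -> `|gR j x - gR j y| <= Lg j * enorm (x - y).
Proof. by move=> Dx Dy; apply: g_lip; [exact: Dx|exact: Dy]. Qed.

Lemma g_dist_domG j x y :
  domG g x -> domG g y -> `|gR j x - gR j y| <= maxJ Lg * Omega.
Proof.
move=> Dx Dy; apply: le_trans (g_lip_domG j Dx Dy) _.
apply: ler_pM; rewrite ?enorm_ge0 ?maxJ_ge ?enorm_domG_le //.
exact/ltW/Lg_gt0.
Qed.

Section Segment.
Variables (x p : 'rV[R]_n) (t : R).
Hypotheses (Dx : domG g x) (Dp : domG g p) (t01 : 0 <= t <= 1).

Lemma segment_econvex j :
  (g j (x + t *: (p - x)) <= (gR j x + t * (gR j p - gR j x))%:E)%E.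
Proof.
have := g_convex j p x t01.
rewrite -(fineK (g_fin_num j Dx)) -(fineK (g_fin_num j Dp)) -!EFinM -EFinD.
have -> : t *: p + (1 - t) *: x = x + t *: (p - x).
  by rewrite scalerBr scalerBl scale1r addrCA.
by move/le_trans; apply; rewrite lee_fin; lra.
Qed.

Lemma segment_domG : domG g (x + t *: (p - x)).
Proof. by move=> j _; apply: le_lt_trans (segment_econvex j) (ltry _). Qed.

Lemma segment_convex j :
  gR j (x + t *: (p - x)) <= gR j x + t * (gR j p - gR j x).
Proof.
by rewrite -lee_fin fineK ?segment_econvex // g_fin_num //; exact: segment_domG.
Qed.

End Segment.

(** A gradient that is Lipschitz on a set of diameter at most [Omega] is
    bounded there, so that [rho] is a genuine supremum. *)
Lemma grad_le_rho j x : domG g x -> enorm (grad (h j) x) <= rho g h.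
Proof.
move=> Dx; apply: sup_upper_bound; last by exists x => //; exists j.
split; first by exists (enorm (grad (h j) x)), x => //; exists j.
exists (maxJ (fun i => enorm (grad (h i) x)) + maxJ L * Omega).
move=> _ [y Dy [i _ <-]].
rewrite -(subrK (grad (h i) x) (grad (h i) y)) addrC.
apply: le_trans (enormD _ _) _; apply: lerD.
  exact: (maxJ_ge (fun i => enorm (grad (h i) x))).
apply: le_trans (h_lip _ _ _) _; apply: ler_pM; rewrite ?enorm_ge0 ?maxJ_ge //.
  exact/ltW/L_gt0.
exact: enorm_domG_le.
Qed.

Lemma rho_ge0 x : domG g x -> 0 <= rho g h.
Proof. by move=> /(grad_le_rho ord0); apply: le_trans; exact: enorm_ge0. Qed.

(** On [domG], [g j] varies by at most [L_G Omega], and [h j] is bounded because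
    it is continuous and [domG] is compact. *)
Lemma Fobj_has_lbound j : has_lbound [set Fobj g h x 0 j | x in domG g].
Proof.
have [->|/set0P[x0 Dx0]] := eqVneq (domG g) set0.
  by exists 0 => y [z []].
have : compact (h j @` domG g).
  apply: continuous_compact => //; apply: continuous_subspaceT => x.
  exact: differentiable_continuous.
move=> /compact_bounded[M [_ /(_ (M + 1))]]; rewrite ltrDl ltr01 => /(_ isT) hM.
exists (gR j x0 - maxJ Lg * Omega - (M + 1)) => _ [x Dx <-].
rewrite FobjE //.
have : `|h j x| <= M + 1 by apply: hM; exists x.
have := g_dist_domG j Dx Dx0.
rewrite !ler_norml => /andP[? _] /andP[? _]; lra.
Qed.

(** The right-hand side does not depend on [j]: it bounds the total decrease of
    any single objective along a run. *)
Lemma Fobj_gap_le j x y : domG g x -> domG g y ->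
  Fobj g h x 0 j - Fobj g h y 0 j <=
  maxJ (fun i => Fobj g h x 0 i) - minJ (fobj_inf g h).
Proof.
move=> Dx Dy; apply: lerB; first exact: (maxJ_ge (fun i => Fobj g h x 0 i)).
apply: le_trans (minJ_le _ j) _.
by apply: ge_inf; [exact: Fobj_has_lbound | exists y].
Qed.

Lemma subpb_maxJ x u : domG g x -> domG g u ->
  subpb g h x u =
  (maxJ (fun j => gR j u - gR j x + dotp (grad (h j) x) (u - x)))%:E.
Proof.
move=> Dx Du; rewrite -bigmaxe_maxJ; apply: eq_bigr => j _.
by rewrite -{1}(fineK (g_fin_num j Du)) -{1}(fineK (g_fin_num j Dx)).
Qed.

(** On [domG] every term of the subproblem at its minimizer is finite, so
    [theta] can be computed as a maximum of real numbers. *)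
Lemma theta_maxJ x p : domG g x -> is_minimizer g h x p ->
  theta g h x = maxJ (fun j => gR j p - gR j x + dotp (grad (h j) x) (p - x)).
Proof.
move=> Dx [Dp pmin]; rewrite /theta.
have -> : ereal_inf (range (subpb g h x)) = subpb g h x p.
  apply/le_anti/andP; split; first by apply: ereal_inf_lbound; exists p.
  by apply/ereal_infP => _ [u _ <-]; exact: pmin.
by rewrite subpb_maxJ.
Qed.

(** The subproblem at [x] takes the value [0] at the point [x] itself. *)
Lemma theta_le0 x p : domG g x -> is_minimizer g h x p -> theta g h x <= 0.
Proof.
move=> Dx pmin; rewrite (theta_maxJ Dx pmin) -lee_fin -subpb_maxJ //; last first.
  by case: pmin.
apply: le_trans (pmin.2 x) _; rewrite subpb_maxJ // lee_fin.
by apply: maxJ_le => j; rewrite !subrr -(subrr x) dotpBr subrr addr0.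
Qed.

Lemma theta_le_range x p : domG g x -> is_minimizer g h x p ->
  `|theta g h x| <= (rho g h + maxJ Lg) * Omega.
Proof.
move=> Dx pmin; have Dp := pmin.1.
rewrite ler0_norm ?(theta_le0 Dx pmin) // (theta_maxJ Dx pmin) lerNl.
apply: le_trans (maxJ_ge _ ord0).
have := g_dist_domG ord0 Dp Dx.
have : `|dotp (grad (h ord0) x) (p - x)| <= rho g h * Omega.
  apply: le_trans (dotp_le_enorm _ _) _.
  by apply: ler_pM; rewrite ?enorm_ge0 ?grad_le_rho ?enorm_domG_le.
rewrite !ler_norml => /andP[? _] /andP[? _]; lra.
Qed.

(** Convexity of [g j] bounds the nonsmooth part of the increment by the
    corresponding fraction of the increment up to [p], and the descent lemma bounds
    the smooth part. *)
Lemma Fobj_segment_le x p t j :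
  domG g x -> is_minimizer g h x p -> 0 <= t <= 1 ->
  Fobj g h (x + t *: (p - x)) 0 j <=
  Fobj g h x 0 j - t * `|theta g h x| + maxJ L * Omega ^+ 2 / 2 * t ^+ 2.
Proof.
move=> Dx pmin t01; have Dp := pmin.1; have /andP[t0 _] := t01.
rewrite ler0_norm ?(theta_le0 Dx pmin) // !FobjE //; last exact: segment_domG.
have gle := segment_convex Dx Dp t01 j.
have hle := descent_lemma x (t *: (p - x)) (h_diff j) (h_lip j).
rewrite dotpZr enormZ exprMn ger0_norm // in hle.
have thetaj : t * (gR j p - gR j x + dotp (grad (h j) x) (p - x)) <= t * theta g h x.
  apply: ler_wpM2l => //; rewrite (theta_maxJ Dx pmin).
  exact: (maxJ_ge (fun j => gR j p - gR j x + dotp (grad (h j) x) (p - x))).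
have quad : L j * enorm (p - x) ^+ 2 <= maxJ L * Omega ^+ 2.
  apply: ler_pM; rewrite ?sqr_ge0 ?maxJ_ge //; first exact/ltW/L_gt0.
  by rewrite ler_pXn2r ?nnegrE ?enorm_ge0 ?(ltW Omega_gt0) // enorm_domG_le.
have := ler_wpM2r (sqr_ge0 t) quad.
lra.
Qed.

(** A rejected trial step cannot be short: on a short step the first-order
    decrease [t |theta|] beats the quadratic error. *)
Lemma armijo_fail x p t zeta :
  domG g x -> is_minimizer g h x p -> 0 < t <= 1 ->
  ~ armijo_test g h zeta x p t ->
  (1 - zeta) * `|theta g h x| <= maxJ L * Omega ^+ 2 / 2 * t.
Proof.
move=> Dx pmin /andP[t0 t1]; rewrite /armijo_test /prec.
move=> /existsNP[j /negP]; rewrite -ltNge !mxE mulr1 => rejected.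
have t01 : 0 <= t <= 1 by rewrite ltW.
have := Fobj_segment_le j Dx pmin t01; rewrite !mxE => increment.
rewrite -(ler_pM2l t0); nra.
Qed.

Lemma gcg_gamma_gt0 x zeta w1 : domG g x -> zeta < 1 -> 0 < w1 ->
  0 < gcg_gamma g h Lg L Omega zeta w1.
Proof.
move=> Dx zeta1 w1_gt0; rewrite lt_min; apply/andP; split.
  by rewrite divr_gt0 // mulr_gt0 // ltr_wpDl ?(rho_ge0 Dx) ?maxJ_gt0.
by rewrite divr_gt0 ?mulr_gt0 ?exprn_gt0 ?maxJ_gt0 ?subr_gt0.
Qed.

(** Either the full step is accepted, and the bound holds because
    [|theta| <= (rho + L_G) Omega], or the last rejected trial step is at most
    [1 / w1] times longer than the accepted one, and it is not short. *)
Lemma armijo_step_ge x p lam zeta w1 w2 :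
  domG g x -> is_minimizer g h x p -> zeta < 1 -> 0 < w1 -> w2 < 1 ->
  armijo_step g h zeta w1 w2 x p lam ->
  gcg_gamma g h Lg L Omega zeta w1 * `|theta g h x| <= lam.
Proof.
move=> Dx pmin zeta1 w1_gt0 w2_lt1 [l [s [s0 trial _ ->]]].
have range_s i : (i <= l)%N -> 0 < s i <= 1.
  elim: i => [|i IHi] il; first by rewrite s0 ltr01 lexx.
  have [_ /andP[lo hi]] := trial i il.
  have /andP[si0 si1] := IHi (ltnW il).
  apply/andP; split; first by apply: lt_le_trans lo; exact: mulr_gt0.
  by apply: le_trans hi _; nra.
case: l trial range_s => [|l] trial range_s.
  have C_gt0 : 0 < (rho g h + maxJ Lg) * Omega.
    by rewrite mulr_gt0 // ltr_wpDl ?(rho_ge0 Dx) ?maxJ_gt0.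
  apply: (@le_trans _ _ (1 / ((rho g h + maxJ Lg) * Omega) * `|theta g h x|)).
    by rewrite ler_wpM2r // ge_min lexx.
  by rewrite s0 mul1r ler_pdivrMl // mulr1; exact: theta_le_range pmin.
have [rejected /andP[lo _]] := trial l (ltnSn l).
have short := armijo_fail Dx pmin (range_s l (leqnSn l)) rejected.
have C_gt0 : 0 < maxJ L * Omega ^+ 2 by rewrite mulr_gt0 ?exprn_gt0 ?maxJ_gt0.
apply: le_trans lo.
apply: (@le_trans _ _
  (2 * w1 * (1 - zeta) / (maxJ L * Omega ^+ 2) * `|theta g h x|)).
  by rewrite ler_wpM2r // ge_min lexx orbT.
rewrite mulrAC ler_pdivrMr //.
have := ler_wpM2l (ltW w1_gt0) short; lra.
Qed.

Lemma armijo_decrease x p lam zeta w1 w2 j :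
  domG g x -> is_minimizer g h x p -> 0 < zeta < 1 -> 0 < w1 -> w2 < 1 ->
  armijo_step g h zeta w1 w2 x p lam ->
  zeta * gcg_gamma g h Lg L Omega zeta w1 * theta g h x ^+ 2 <=
  Fobj g h x 0 j - Fobj g h (x + lam *: (p - x)) 0 j.
Proof.
move=> Dx pmin /andP[zeta0 zeta1] w1_gt0 w2_lt1 step.
have lam_ge := armijo_step_ge Dx pmin zeta1 w1_gt0 w2_lt1 step.
have [l [s [_ _ /(_ j) + lamE]]] := step; rewrite -lamE !mxE mulr1 => accepted.
rewrite -(real_normK (num_real (theta g h x))).
have := ler_wpM2l (ltW zeta0) (ler_wpM2r (normr_ge0 (theta g h x)) lam_ge).
lra.
Qed.

(** Relative to [domG] the objective is continuous, because [g j] is Lipschitz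
    there, even if [g j] jumps to [+oo] at the boundary of [domG]. *)
Lemma Fobj_cluster j (x : nat -> 'rV[R]_n) (xs : 'rV[R]_n) (a : R) :
  (forall k, domG g (x k)) -> domG g xs -> cluster (x @ \oo) xs ->
  Fobj g h (x k) 0 j @[k --> \oo] --> a -> Fobj g h xs 0 j = a.
Proof.
move=> Dx Dxs xs_cluster Fa; apply/eqP; rewrite -subr_eq0 -normr_le0.
apply/ler_addgt0Pr => e e_gt0; rewrite add0r.
have e3_gt0 : 0 < e / 3 by rewrite divr_gt0.
have near_a : \forall k \near \oo, `|a - Fobj g h (x k) 0 j| < e / 3.
  by move/cvgrPdist_lt: Fa; apply.
have near_h : \forall y \near xs, `|h j xs - h j y| < e / 3.
  by have /cvgrPdist_lt := differentiable_continuous (h_diff j xs); apply.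
have near_g : \forall y \near xs, Lg j * enorm (y - xs) < e / 3.
  have e3L : 0 < e / 3 / Lg j by rewrite divr_gt0.
  have /cvgrPdist_lt/(_ _ e3L) := cvg_enorm_sub xs.
  apply: filterS => y; rewrite sub0r normrN ger0_norm ?enorm_ge0 //.
  by rewrite ltr_pdivlMr // mulrC.
(* The cluster property provides one index that is both late enough for the
   values to be close to [a] and at which the iterate is close to [xs]. *)
have [_ [[k ka <-] [kh kg]]] :
    ((x @` [set k | `|a - Fobj g h (x k) 0 j| < e / 3]) `&`
     [set y | `|h j xs - h j y| < e / 3 /\ Lg j * enorm (y - xs) < e / 3]) !=set0.
  apply: xs_cluster; last exact: filterI.
  by apply: filterS near_a => k ka; exists k.
have := g_lip_domG j (Dx k) Dxs.
move: ka kh; rewrite /= (FobjE j (Dx k)) (FobjE j Dxs) !ltr_norml !ler_norml.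
move=> /andP[? ?] /andP[? ?] /andP[? ?]; apply/andP; split; lra.
Qed.

End CompositeObjective.

(** * Convergence of the run *)

Section Sequences.
Context {R : realType}.

Lemma rV_cvg n (u : nat -> 'rV[R]_n) (l : 'rV[R]_n) :
  (forall j, u k 0 j @[k --> \oo] --> l 0 j) -> u k @[k --> \oo] --> l.
Proof.
move=> ul A [P nbhsP PA].
have : \forall k \near \oo, forall j, P 0 j (u k 0 j).
  by apply: filter_forall => j; exact: ul (nbhsP 0 j).
by apply: filterS => k Pk; apply: PA => i j; rewrite ord1.
Qed.

(** Since [u] converges, its decrements tend to zero. *)
Lemma sqr_le_decrements_cvg0 (c : R) (u v : nat -> R) (a : R) :
  0 < c -> u k @[k --> \oo] --> a ->
  (forall k, c * v k ^+ 2 <= u k - u k.+1) -> v k @[k --> \oo] --> (0 : R).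
Proof.
move=> c_gt0 ua vu.
have decr : u k - u k.+1 @[k --> \oo] --> (0 : R).
  rewrite -(subrr a); apply: cvgB => //.
  by move: ua; rewrite -cvg_shiftS.
apply/cvgrPdist_lt => e e_gt0.
have ce_gt0 : 0 < c * e ^+ 2 by rewrite mulr_gt0 ?exprn_gt0.
move/cvgrPdist_lt: decr => /(_ _ ce_gt0).
apply: filterS => k; rewrite !sub0r !normrN => /(le_lt_trans (ler_norm _)).
move=> /(le_lt_trans (vu k)); rewrite ltr_pM2l // -real_normK ?num_real //.
by rewrite ltr_pXn2r // ?nnegrE ?normr_ge0 // ltW.
Qed.

Lemma decrements_ge (d : R) (u : nat -> R) N :
  (forall k, (k < N)%N -> d <= u k - u k.+1) -> N%:R * d <= u 0%N - u N.
Proof.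
elim: N => [|N IHN] du; first by rewrite mul0r subrr.
have := IHN (fun k kN => du k (ltnW kN)); have := du N (ltnSn N).
by rewrite -natr1; lra.
Qed.

End Sequences.

Theorem theorem10 (R : realType) (n m : nat)
    (g : 'I_m.+1 -> 'rV[R]_n -> \bar R) (h : 'I_m.+1 -> 'rV[R]_n -> R)
    (Lg L : 'I_m.+1 -> R) (Omega zeta w1 w2 : R)
    (x p : nat -> 'rV[R]_n) (lam : nat -> R)
    (hC1 : forall j, continuously_differentiable (h j))
    (g_proper : forall j, eproper (g j))
    (g_convex : forall j, econvex (g j))
    (g_lsc : forall j, lower_semicontinuous (g j))
    (domG_convex : convex_set (domG g))
    (domG_compact : compact (domG g))
    (Lg_gt0 : forall j, 0 < Lg j)
    (g_lip : forall j, lipschitz_on_dom (Lg j) (g j))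
    (L_gt0 : forall j, 0 < L j)
    (h_lip : forall j, lipschitz_gradient (L j) (h j))
    (Omega_gt0 : 0 < Omega)
    (Omega_diam : (diam (domG g) <= Omega%:E)%E)
    (zeta01 : 0 < zeta < 1)
    (w1_gt0 : 0 < w1) (w12 : w1 < w2) (w2_lt1 : w2 < 1)
    (run : gcg_run g h x p lam)
    (armijo : forall k, armijo_step g h zeta w1 w2 (x k) (p k) (lam k)) :
  (exists xs : 'rV[R]_n,
     domG g xs /\ Fobj g h (x k) @[k --> \oo] --> Fobj g h xs) /\
  (theta g h (x k) @[k --> \oo] --> (0 : R)) /\
  (forall N : nat, (0 < N)%N ->
     \big[Num.min/`|theta g h (x 0%N)|]_(k < N) `|theta g h (x k)| <=
     Num.sqrt ((maxJ (fun j => Fobj g h (x 0%N) 0 j) - minJ (fobj_inf g h)) /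
               (zeta * gcg_gamma g h Lg L Omega zeta w1 * N%:R))).
Proof.
have h_diff j y : differentiable (h j) y by exact: (hC1 j).1.
have [x0D steps] := run; have /andP[zeta_gt0 zeta_lt1] := zeta01.
have xD k : domG g (x k).
  elim: k => [//|k IHk]; have [[pD _] _ /andP[lam_gt0 lam_le1] ->] := steps k.
  by apply: segment_domG => //; rewrite ltW.
pose c := zeta * gcg_gamma g h Lg L Omega zeta w1.
have c_gt0 : 0 < c.
  by rewrite mulr_gt0 //; apply: gcg_gamma_gt0 x0D zeta_lt1 w1_gt0.
have decrease j k :
    c * theta g h (x k) ^+ 2 <= Fobj g h (x k) 0 j - Fobj g h (x k.+1) 0 j.
  have [pmin _ _ ->] := steps k.
  exact: (armijo_decrease h_diff g_proper g_convex Lg_gt0 g_lip L_gt0 h_lip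
    Omega_gt0 Omega_diam j (xD k) pmin zeta01 w1_gt0 w2_lt1 (armijo k)).
have F_cvg j : Fobj g h (x k) 0 j @[k --> \oo] -->
    inf (range (fun k => Fobj g h (x k) 0 j)).
  apply: nonincreasing_cvgn.
    apply/nonincreasing_seqP => k; rewrite -subr_ge0.
    by apply: le_trans (decrease j k); rewrite mulr_ge0 ?sqr_ge0 ?ltW.
  have [b lb_b] : has_lbound [set Fobj g h y 0 j | y in domG g].
    exact: (Fobj_has_lbound h_diff g_proper domG_compact Lg_gt0 g_lip Omega_diam).
  by exists b => _ [k _ <-]; apply: lb_b; exists (x k).
split; [|split].
- have [xs [xsD xs_cluster]] : domG g `&` cluster (x @ \oo) !=set0.
    by apply: domG_compact; exists 0%N => // k _; exact: xD.
  exists xs; split=> //; apply: rV_cvg => j.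
  by rewrite (Fobj_cluster h_diff g_proper Lg_gt0 g_lip xD xsD xs_cluster (F_cvg j)).
- exact: sqr_le_decrements_cvg0 c_gt0 (F_cvg ord0) (decrease ord0).
- move=> N N_gt0; set M := \big[Num.min/_]_(k < N) _.
  have M_ge0 : 0 <= M by apply: le_bigmin => [|k _]; exact: normr_ge0.
  have M_le k : (k < N)%N -> c * M ^+ 2 <=
      Fobj g h (x k) 0 ord0 - Fobj g h (x k.+1) 0 ord0.
    move=> kN; apply: le_trans (decrease ord0 k); rewrite ler_pM2l //.
    rewrite -(real_normK (num_real (theta g h (x k)))) ler_pXn2r ?nnegrE //.
    exact: (bigmin_le _ (Ordinal kN) (fun k : 'I_N => `|theta g h (x k)|)).
  have cN_gt0 : 0 < c * N%:R by rewrite mulr_gt0 ?ltr0n.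
  rewrite -(ger0_norm M_ge0) -sqrtr_sqr ler_wsqrtr // ler_pdivlMr //.
  apply: (@le_trans _ _ (Fobj g h (x 0%N) 0 ord0 - Fobj g h (x N) 0 ord0)).
    by have := decrements_ge M_le; rewrite /c; lra.
  exact: (Fobj_gap_le h_diff g_proper domG_compact Lg_gt0 g_lip Omega_diam).
Qed.
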